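(* Let $p,q,m,n\in\mathbb{N}_0$ with $m\le n$, let $y=\sum_{k=0}^\infty c_k\phi_k$ be a formal series in an orthogonal polynomial basis $\{\phi_k\}_{k\ge0}$, let $y_n=\sum_{k=0}^nc_k^{(n)}\phi_k$, and let $\Phi_{p,q}(y_n)$ be the $(p,q)$ Padé filter from $y_n$. Suppose that for some finite and nonzero constant $\rho\in\mathbb{R}$ one has $c_k^{(n)}=\rho\,c_k$ for $k=0,\dots,m$. Then: (a) If $p+2q\le m$ and $\mathbf{H}_{y_n}^{[p/q]}$ is regular (nonsingular), then $\Phi_{p,q}(y_n)=\rho\,\Phi_{p,q}(y)$. (b) If $p\le m-2$ and $\mathbf{H}_{y_n}^{[p/1]}$ is regular, then $\lambda_p^{(n)}=\lambda_p$, that is, the pole of the filter $\Phi_{p,1}(y_n)$ coincides with the pole of $\Phi_{p,1}(y)$. (c) If $p\le m-4$ and $\mathbf{H}_{y_n}^{[p/2]}$ is regular, then $\lambda_{p^\pm}^{(n)}=\lambda_{p^\pm}$, that is, the poles of the filter $\Phi_{p,2}(y_n)$ coincide with the poles of $\Phi_{p,2}(y)$.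
   Context: $\{\phi_i\}_{i\ge0}$ is a family of real polynomials, $\deg\phi_i=i$, orthogonal on an interval $I\subset\mathbb{R}$ with respect to a weight $w$, satisfying $t\phi_i=\alpha_i\phi_{i+1}+\beta_i\phi_i+\gamma_i\phi_{i-1}$ for $i\ge1$, $\phi_0=1$, $\phi_1=(t-\beta_0)/\alpha_0$. For a formal series $y=\sum_kc_k\phi_k$ (real coefficients), define $h_{j,i}$ by the formal product $\phi_iy=\sum_{j\ge0}h_{j,i}\phi_j$, obtained by re-expanding each $\phi_i\phi_k$ in the basis (it involves only $\phi_j$ with $|i-k|\le j\le i+k$, so each $h_{j,i}$ is a finite sum). Set $$\mathbf{g}_y^{[p/q]}=[h_{0,q},\dots,h_{p,q}]^T,\quad \mathbf{h}_y^{[p/q]}=[h_{p+1,q},\dots,h_{p+q,q}]^T,$$ $$\mathbf{G}_y^{[p/q]}=[h_{j,i}]_{0\le j\le p,\;0\le i\le q-1},\quad \mathbf{H}_y^{[p/q]}=[h_{j,i}]_{p+1\le j\le p+q,\;0\le i\le q-1},$$ with $j$ the row index and $i$ the column index (for $q=0$ the matrix $\mathbf{H}$ is empty and counts as regular). When $\mathbf{H}_y^{[p/q]}$ is nonsingular, the normalized Frobenius-Padé approximant of type $(p,q)$ is $\Phi_{p,q}(y)=N_{p,q}(y)/D_{p,q}(y)$, with $N_{p,q}(y)=\sum_{i=0}^pa_i\phi_i$, $D_{p,q}(y)=\phi_q+\sum_{i=0}^{q-1}b_i\phi_i$, where $\mathbf{H}_y^{[p/q]}\mathbf{b}=-\mathbf{h}_y^{[p/q]}$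 and $\mathbf{a}=\mathbf{G}_y^{[p/q]}\mathbf{b}+\mathbf{g}_y^{[p/q]}$. The Padé filter $\Phi_{p,q}(y_n)$ is the approximant built in the same way from $y_n$ regarded as a series with zero coefficients beyond index $n$ (in the paper $y_n$ is a Tau-method approximation of $y$, but only its coefficients matter here). A pole of $\Phi_{p,q}$ means a (possibly complex) zero of its denominator $D_{p,q}$, without regard to possible common zeros with the numerator: $\lambda_p,\lambda_p^{(n)}$ are the zeros of $D_{p,1}(y),D_{p,1}(y_n)$, and $\lambda_{p^\pm},\lambda_{p^\pm}^{(n)}$ are the pairs of zeros, counted with multiplicity, of $D_{p,2}(y),D_{p,2}(y_n)$. *)

(* Defs.v *)
From HB Require Import structures.
From mathcomp Require Import all_boot all_order all_algebra.
From mathcomp Require Import complex.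
From mathcomp Require Import all_classical all_reals all_analysis.
Set Implicit Arguments.
Unset Strict Implicit.
Unset Printing Implicit Defensive.
Import Order.TTheory GRing.Theory Num.Theory.
Import numFieldNormedType.Exports.
Local Open Scope classical_set_scope.
Local Open Scope ring_scope.

Record is_weight (R : realType) (I : interval R) (w : R -> R) : Prop := {
  weight_ge0 : forall t, t \in I -> 0 <= w t ;
  weight_moments : forall k : nat,
    (@lebesgue_measure R).-integrable [set` I] (fun t => (t ^+ k * w t)%:E) ;
  weight_mass : 0 < \int[@lebesgue_measure R]_(t in [set` I]) w t }.

Record is_orthogonal_basis (R : realType) (I : interval R) (w : R -> R)
    (phi : nat -> {poly R}) : Prop := {
  basis_size : forall i, size (phi i) = i.+1 ;
  basis_orthogonal : forall i j, i != j ->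
    \int[@lebesgue_measure R]_(t in [set` I])
      ((phi i).[t] * (phi j).[t] * w t) = 0 }.

(* [gamma 0] is unconstrained. *)
Record three_term (R : realType) (phi : nat -> {poly R})
    (alpha beta gamma : nat -> R) : Prop := {
  three_term0 : phi 0%N = 1 ;
  three_term1 : phi 1%N = (alpha 0%N)^-1 *: ('X - (beta 0%N)%:P) ;
  three_termS : forall i, (0 < i)%N ->
    'X * phi i = alpha i *: phi i.+1 + beta i *: phi i + gamma i *: phi i.-1 }.

Section Coordinates.
Variables (R : realType) (phi : nat -> {poly R}).

Fixpoint basis_coord_rec (n : nat) (f : {poly R}) (j : nat) : R :=
  if n is l.+1 then
    let a := f`_l / lead_coef (phi l) in
    if j == l then a else basis_coord_rec l (f - a *: phi l) j
  else 0.

(* The coefficient of [phi j] in the expansion of [f] in the basis [phi]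
   (see [basis_coordK] and [basis_coord_phi]). *)
Definition basis_coord (f : {poly R}) (j : nat) : R :=
  basis_coord_rec (size f) f j.

Lemma basis_coord_rec_linear n a f g j :
  basis_coord_rec n (a *: f + g) j =
  a * basis_coord_rec n f j + basis_coord_rec n g j.
Proof.
elim: n f g => [|n IH] f g /=; first by rewrite mulr0 addr0.
rewrite coefD coefZ; case: eqP => _; first by rewrite mulrDl mulrA.
rewrite -IH; congr basis_coord_rec.
by rewrite mulrDl scalerDl scalerBr opprD scalerA mulrA addrACA.
Qed.

Hypothesis size_phi : forall i, size (phi i) = i.+1.

Lemma basis_lead_neq0 i : lead_coef (phi i) != 0.
Proof. by rewrite lead_coef_eq0 -size_poly_eq0 size_phi. Qed.

Lemma basis_size_step n (f : {poly R}) : (size f <= n.+1)%N ->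
  (size (f - (f`_n / lead_coef (phi n)) *: phi n)%R <= n)%N.
Proof.
move=> sf; apply/leq_sizeP => k; rewrite coefB coefZ leq_eqVlt => /predU1P[<-|nk].
  have -> : (phi n)`_n = lead_coef (phi n) by rewrite /lead_coef size_phi.
  by rewrite divfK ?basis_lead_neq0 ?subrr.
have -> : f`_k = 0 by rewrite nth_default // (leq_trans sf).
have -> : (phi n)`_k = 0 by rewrite nth_default // size_phi.
by rewrite mulr0 subrr.
Qed.

Lemma basis_coord_recE n (f : {poly R}) j : (size f <= n)%N ->
  basis_coord_rec n f j = basis_coord f j.
Proof.
rewrite /basis_coord => /subnK <-; elim: (n - size f)%N => [//|k IH].
rewrite addSn /= nth_default ?leq_addl // mul0r scale0r subr0 IH.
case: eqP => // ej; rewrite -IH ej; move: (k + size f)%N => l {IH ej}.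
suff H m g : (m <= l)%N -> basis_coord_rec m g l = 0 by rewrite H.
elim: m g => //= m IH g lm; rewrite gtn_eqF // IH //; exact: ltnW.
Qed.

Lemma basis_coord_linear a f g j :
  basis_coord (a *: f + g) j = a * basis_coord f j + basis_coord g j.
Proof.
pose n := maxn (size f) (maxn (size g) (size (a *: f + g))).
by rewrite -!(@basis_coord_recE n) ?basis_coord_rec_linear // !leq_max leqnn ?orbT.
Qed.

Lemma basis_coordK (f : {poly R}) :
  f = \sum_(j < size f) basis_coord f j *: phi j.
Proof.
suff H n (g : {poly R}) : (size g <= n)%N ->
    g = \sum_(j < n) basis_coord_rec n g j *: phi j.
  exact: H.
elim: n g => [|n IH] {}f sf.
  by rewrite big_ord0; apply/eqP; rewrite -size_poly_leq0.
rewrite big_ord_recr /= eqxx.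
rewrite (eq_bigr (fun j : 'I_n => basis_coord_rec n
  (f - (f`_n / lead_coef (phi n)) *: phi n) j *: phi j)) => [|j _]; last first.
  by rewrite ltn_eqF.
by rewrite -IH ?subrK // basis_size_step.
Qed.

Lemma basis_coord0 j : basis_coord 0 j = 0.
Proof. by rewrite /basis_coord size_poly0. Qed.

Lemma basis_coord_phi k j : basis_coord (phi k) j = (j == k)%:R.
Proof.
rewrite /basis_coord size_phi /=.
have -> : (phi k)`_k = lead_coef (phi k) by rewrite /lead_coef size_phi.
rewrite divff ?basis_lead_neq0 // scale1r subrr; case: eqP => // _.
by rewrite basis_coord_recE ?size_poly0 // basis_coord0.
Qed.

Lemma basis_coord_sum n (a : 'I_n -> R) (F : 'I_n -> {poly R}) j :
  basis_coord (\sum_i a i *: F i) j = \sum_i a i * basis_coord (F i) j.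
Proof.
elim: n a F => [|n IH] a F; first by rewrite !big_ord0 basis_coord0.
by rewrite !big_ord_recl basis_coord_linear IH.
Qed.

Variables alpha beta gamma : nat -> R.
Hypothesis rec_phi : three_term phi alpha beta gamma.

Definition vanish_below (a : nat) (f : {poly R}) :=
  forall j, (j < a)%N -> basis_coord f j = 0.

Lemma vanish_below_sum a n (b : 'I_n -> R) (F : 'I_n -> {poly R}) :
  (forall i, vanish_below a (F i)) -> vanish_below a (\sum_i b i *: F i).
Proof.
by move=> lF j ja; rewrite basis_coord_sum big1 // => i _; rewrite lF ?mulr0.
Qed.

Lemma vanish_below_mulX a f : vanish_below a.+1 f -> vanish_below a ('X * f).
Proof.
move=> lf j ja; rewrite (basis_coordK f) mulr_sumr.
under eq_bigr do rewrite -scalerAr.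
rewrite basis_coord_sum big1 // => -[l /= _] _.
have [la|al] := ltnP l a.+1; first by rewrite lf ?mul0r.
rewrite (three_termS rec_phi) ?(leq_ltn_trans _ al) // -addrA !basis_coord_linear.
rewrite -[gamma l *: _]addr0 basis_coord_linear basis_coord0 !basis_coord_phi.
case: l al => // l al; have jl : (j < l)%N := leq_trans ja al.
by rewrite /= !ltn_eqF ?mulr0 ?addr0 ?mulr0 // !leqW.
Qed.

Lemma vanish_below_mulXn a n f : vanish_below (n + a) f ->
  vanish_below a ('X^n * f).
Proof.
elim: n a => [|n IH] a lf; first by rewrite expr0 mul1r.
by rewrite exprS -mulrA; apply/vanish_below_mulX/IH; rewrite addnS.
Qed.

(* The sums in [hcoef] below have finite support. *)
Lemma basis_coord_mul_phi_eq0 i k j : (i + j < k)%N ->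
  basis_coord (phi i * phi k) j = 0.
Proof.
move=> ijk; rewrite -[phi i]coefK poly_def size_phi mulr_suml.
under eq_bigr do rewrite -scalerAl.
apply: (@vanish_below_sum j.+1) => // l; apply: vanish_below_mulXn => s sl.
rewrite basis_coord_phi ltn_eqF // (leq_trans _ ijk) // (leq_trans sl) //.
by rewrite addnS ltnS leq_add2r -ltnS.
Qed.

End Coordinates.

Section FrobeniusPade.
Variables (R : realType) (phi : nat -> {poly R}).

(* A formal series [\sum_k c k * phi k] is represented by its coefficients [c]. *)
Definition truncated_series (n : nat) (c : nat -> R) : nat -> R :=
  fun k => if (k <= n)%N then c k else 0.

Variable c : nat -> R.

(* [phi i * y = \sum_j hcoef j i * phi j] *)
Definition hcoef (j i : nat) : R :=
  \sum_(k \in [set: nat]) c k * basis_coord phi (phi i * phi k) j.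

Variables p q : nat.

Definition pade_g : 'cV[R]_p.+1 := \col_j hcoef j q.
Definition pade_h : 'cV[R]_q := \col_(j < q) hcoef (p.+1 + j)%N q.
Definition pade_G : 'M[R]_(p.+1, q) := \matrix_(j, i) hcoef j i.
Definition pade_H : 'M[R]_q := \matrix_(j < q, i < q) hcoef (p.+1 + j)%N i.

(* Meaningful when [pade_H \in unitmx]. *)
Definition pade_b : 'cV[R]_q := invmx pade_H *m (- pade_h).
Definition pade_a : 'cV[R]_p.+1 := pade_G *m pade_b + pade_g.

Lemma pade_bP : pade_H \in unitmx -> pade_H *m pade_b = - pade_h.
Proof. by move=> uH; rewrite mulKVmx. Qed.

Definition pade_N : {poly R} := \sum_(i < p.+1) pade_a i 0 *: phi i.
Definition pade_D : {poly R} := phi q + \sum_(i < q) pade_b i 0 *: phi i.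

Definition pade_approximant : {fraction {poly R}} :=
  tofrac pade_N / tofrac pade_D.

End FrobeniusPade.

Section Zeros.
Variable R : realType.

(* The complex zeros of a nonzero real polynomial, listed with multiplicity. *)
Definition complex_zeros (f : {poly R}) : seq R[i] :=
  sval (closed_field_poly_normal (map_poly (real_complex R) f)).

Lemma complex_zerosP (f : {poly R}) :
  map_poly (real_complex R) f =
  (real_complex R (lead_coef f)) *: \prod_(z <- complex_zeros f) ('X - z%:P).
Proof.
rewrite /complex_zeros; case: closed_field_poly_normal => /= s.
by rewrite lead_coef_map.
Qed.

End Zeros.

(* The poles of the approximant are the zeros of its denominator, whether or
   not they cancel with zeros of the numerator. *)
Definition pade_poles (R : realType) (phi : nat -> {poly R}) (c : nat -> R)
    (p q : nat) : seq R[i] :=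
  complex_zeros (pade_D phi c p q).

(* Main.v *)
(* The approximant of type (p, q) only involves the entries h_{j,i} with
   j <= p + q and i <= q, and these only depend on the coefficients c_k with
   k <= i + j <= p + 2q <= m. So passing from y to y_n multiplies g, h, G and H
   by rho; the linear system H b = - h, hence the denominator and its zeros,
   is unaffected, while the numerator is multiplied by rho. *)

Require Import Defs.
From mathcomp Require Import all_boot all_order all_algebra.
From mathcomp Require Import complex.
From mathcomp Require Import all_classical all_reals all_analysis.
Import Order.TTheory GRing.Theory Num.Theory.
Local Open Scope ring_scope.

Set Implicit Arguments.
Unset Strict Implicit.

(** By the three-term recurrence, [phi i * phi k] has no component on [phi j] once [k > i + j]. This
    bounds the highest coefficient of the series that an entry can see. *)
Lemma hcoef_finite_sum (R : realType) (phi : nat -> {poly R})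
    (alpha beta gamma : nat -> R) :
  (forall i, size (phi i) = i.+1) -> three_term phi alpha beta gamma ->
  forall (c : nat -> R) (j i : nat),
  hcoef phi c j i =
    \sum_(k < (i + j).+1) c k * basis_coord phi (phi i * phi k) j.
Proof.
move=> sphi rphi c j i.
rewrite (fsbig_ord _ _ (fun k => c k * basis_coord phi (phi i * phi k) j)).
apply/esym/fsbig_widen => // k [_] /= /negP; rewrite -leqNgt => ijk.
by rewrite (basis_coord_mul_phi_eq0 sphi rphi ijk) mulr0.
Qed.

Lemma hcoef_scale (R : realType) (phi : nat -> {poly R})
    (alpha beta gamma : nat -> R) :
  (forall i, size (phi i) = i.+1) -> three_term phi alpha beta gamma ->
  forall (m : nat) (c d : nat -> R) (rho : R),
  (forall k, (k <= m)%N -> d k = rho * c k) ->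
  forall j i, (i + j <= m)%N -> hcoef phi d j i = rho * hcoef phi c j i.
Proof.
move=> sphi rphi m c d rho dc j i ijm.
rewrite !(hcoef_finite_sum sphi rphi) mulr_sumr.
apply: eq_bigr => k _; rewrite dc ?mulrA //.
by rewrite (leq_trans _ ijm) // -ltnS.
Qed.

Section PadeScale.
Variables (R : realType) (phi : nat -> {poly R}) (c d : nat -> R) (rho : R).
Variables p q : nat.
Hypothesis rho_neq0 : rho != 0.
Hypothesis hcoefZ : forall j i, (j <= p + q)%N -> (i <= q)%N ->
  hcoef phi d j i = rho * hcoef phi c j i.

Let row_bound (j : 'I_q) : (p.+1 + j <= p + q)%N.
Proof. by rewrite addSnnS leq_add2l. Qed.

Let row_boundl (j : 'I_p.+1) : (j <= p + q)%N.
Proof. by rewrite (leq_trans _ (leq_addr _ _)) // -ltnS. Qed.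

Lemma pade_H_scale : pade_H phi d p q = rho *: pade_H phi c p q.
Proof. by apply/matrixP => j i; rewrite !mxE hcoefZ ?row_bound // ltnW. Qed.

(** Regularity is assumed for the filter only; since [rho] is invertible, it transfers to the matrix
    of the original series. *)
Lemma pade_H_scale_unit :
  (pade_H phi d p q \in unitmx) = (pade_H phi c p q \in unitmx).
Proof. by rewrite pade_H_scale unitmxZ // unitfE. Qed.

Hypothesis regular_H : pade_H phi d p q \in unitmx.

Lemma pade_b_scale : pade_b phi d p q = pade_b phi c p q.
Proof.
have hE : pade_h phi d p q = rho *: pade_h phi c p q.
  by apply/matrixP => j i; rewrite !mxE hcoefZ ?row_bound.
(* Multiplication by the regular matrix of [d] is injective, so it suffices that the vector for [c]
   also solves the system of [d], which is the system of [c] multiplied by [rho]. *)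
apply: (can_inj (mulKmx regular_H)); rewrite pade_bP // pade_H_scale -scalemxAl.
by rewrite pade_bP -?pade_H_scale_unit // hE scalerN.
Qed.

Lemma pade_D_scale : pade_D phi d p q = pade_D phi c p q.
Proof. by rewrite /pade_D pade_b_scale. Qed.

(** In [a = G b + g] the vector [b] is unchanged, while [G] and [g] each pick up the factor
    [rho]. *)
Lemma pade_N_scale : pade_N phi d p q = rho *: pade_N phi c p q.
Proof.
have gE : pade_g phi d p q = rho *: pade_g phi c p q.
  by apply/matrixP => j i; rewrite !mxE hcoefZ ?row_boundl.
have GE : pade_G phi d p q = rho *: pade_G phi c p q.
  by apply/matrixP => j i; rewrite !mxE hcoefZ ?row_boundl // ltnW.
rewrite /pade_N scaler_sumr; apply: eq_bigr => i _.
by rewrite scalerA /pade_a pade_b_scale gE GE -scalemxAl -scalerDr mxE.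
Qed.

Lemma pade_approximant_scale :
  pade_approximant phi d p q = tofrac rho%:P * pade_approximant phi c p q.
Proof.
by rewrite /pade_approximant pade_N_scale pade_D_scale -mul_polyC rmorphM mulrA.
Qed.

End PadeScale.

Lemma size_complex_zeros (R : realType) (f : {poly R}) :
  f != 0 -> size (complex_zeros f) = (size f).-1.
Proof.
move=> f0; rewrite -(size_map_poly (real_complex R)) complex_zerosP.
by rewrite size_scale ?size_prod_XsubC // fmorph_eq0 lead_coef_eq0.
Qed.

(** The normalization gives [phi q] coefficient 1, and the remaining terms have degree below [q], so
    the leading term cannot cancel. *)
Lemma size_pade_D (R : realType) (phi : nat -> {poly R}) (c : nat -> R)
    (p q : nat) :
  (forall i, size (phi i) = i.+1) -> size (pade_D phi c p q) = q.+1.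
Proof.
move=> sphi; rewrite /pade_D size_polyDl ?sphi // ltnS.
rewrite (leq_trans (size_sum _ _ _)) //; apply/bigmax_leqP => i _.
by rewrite (leq_trans (size_scale_leq _ _)) ?sphi.
Qed.

Lemma size_pade_poles (R : realType) (phi : nat -> {poly R}) (c : nat -> R)
    (p q : nat) :
  (forall i, size (phi i) = i.+1) -> size (pade_poles phi c p q) = q.
Proof.
move=> sphi; rewrite size_complex_zeros ?size_pade_D //.
by rewrite -size_poly_eq0 size_pade_D.
Qed.

Theorem corollary6 (R : realType) (I : interval R) (w : R -> R)
    (phi : nat -> {poly R}) (alpha beta gamma : nat -> R)
    (hw : is_weight I w) (hphi : is_orthogonal_basis I w phi)
    (hrec : three_term phi alpha beta gamma)
    (p q m n : nat) (hmn : (m <= n)%N)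
    (c cn : nat -> R) (rho : R) (hrho : rho != 0)
    (hc : forall k, (k <= m)%N -> cn k = rho * c k) :
  let y := c in
  let yn := truncated_series n cn in
  [/\ (p + 2 * q <= m)%N -> pade_H phi yn p q \in unitmx ->
        pade_H phi y p q \in unitmx /\
        pade_approximant phi yn p q =
          tofrac rho%:P * pade_approximant phi y p q,
      (p + 2 <= m)%N -> pade_H phi yn p 1 \in unitmx ->
        pade_H phi y p 1 \in unitmx /\
        exists lambda : R[i],
          pade_poles phi yn p 1 = [:: lambda] /\
          pade_poles phi y p 1 = [:: lambda]
    & (p + 4 <= m)%N -> pade_H phi yn p 2 \in unitmx ->
        pade_H phi y p 2 \in unitmx /\
        exists lambdap lambdam : R[i],
          perm_eq (pade_poles phi yn p 2) [:: lambdap; lambdam] /\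
          perm_eq (pade_poles phi y p 2) [:: lambdap; lambdam]].
Proof.
move=> y yn.
have sphi := basis_size hphi.
(* As [m <= n], truncation at [n] leaves these coefficients untouched. *)
have ync k : (k <= m)%N -> yn k = rho * y k.
  by move=> km; rewrite /yn /truncated_series (leq_trans km hmn) hc.
(* The denominator degree [r] is kept free: the values [q], 1 and 2 yield the three thresholds of
   the theorem. The extreme index is [i + j = r + (p + r)]. *)
have scaled r : (p + 2 * r <= m)%N -> forall j i, (j <= p + r)%N -> (i <= r)%N ->
    hcoef phi yn j i = rho * hcoef phi y j i.
  move=> prm j i jpr ir; apply: (hcoef_scale sphi hrec ync).
  by rewrite (leq_trans _ prm) // addnC mul2n -addnn addnA leq_add.
split=> le_m uH.
- have hZ := scaled q le_m; split; first by rewrite -(pade_H_scale_unit hrho hZ).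
  exact: pade_approximant_scale.
- have hZ := scaled 1%N le_m; split; first by rewrite -(pade_H_scale_unit hrho hZ).
  (* Equal denominators have the same list of zeros, so a single list remains, and its length is
     known from the degree. *)
  rewrite /pade_poles (pade_D_scale hrho hZ uH) -/(pade_poles _ _ _ _).
  have := size_pade_poles y p 1 sphi.
  by case: pade_poles => [|z [|//]] // _; exists z.
- have hZ := scaled 2 le_m; split; first by rewrite -(pade_H_scale_unit hrho hZ).
  rewrite /pade_poles (pade_D_scale hrho hZ uH) -/(pade_poles _ _ _ _).
  have := size_pade_poles y p 2 sphi.
  by case: pade_poles => [|z [|u [|//]]] // _; exists z, u.
Qed.
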